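(* Let $G$ be a finite simple undirected graph of diameter $d\ge 2$, and let $D\subseteq\{0,1,\ldots,d\}$ be such that $2\in D$ and $0\notin D$. If $G$ contains either (1) two distinct pendant vertices (vertices of degree $1$) adjacent to a common vertex, or (2) two vertices at distance $2$ having the same neighborhood, then $G$ is not $D$-distance magic.
   Context: Let $G=(V,E)$ be a finite simple undirected graph with $v=|V|$ vertices, and let $d(x,y)$ be the graph distance (vertices in different connected components are at infinite distance; for a non-connected graph, $d$ denotes the largest diameter of a connected component). The neighborhood of a vertex is the set of vertices adjacent to it. For a set $D$ of nonnegative integers and $x\in V$, put $N_D(x)=\{y\in V : d(x,y)\in D\}$. A $D$-distance magic labeling of $G$ is a bijection $f:V\to\{1,2,\ldots,v\}$ for which there is a constant $\mathsf{k}$ such that $\sum_{y\in N_D(x)} f(y)=\mathsf{k}$ for every $x\in V$. $G$ is called $D$-distance magic if it admits a $D$-distance magic labeling. *)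

(* Defs.v *)
From mathcomp Require Import all_boot.

Set Implicit Arguments.
Unset Strict Implicit.
Unset Printing Implicit Defensive.

(* A finite simple undirected graph is a symmetric irreflexive e : rel V on
   V : finType. *)
Section Graph.

Variables (V : finType) (e : rel V).

Definition nbhd (x : V) : {set V} := [set y | e x y].

Definition pendant (x : V) : bool := #|nbhd x| == 1.

Definition walk_of_length (x y : V) (n : nat) : bool :=
  [exists p : n.-tuple V, path e x p && (last x p == y)].

Lemma connect_walk (x y : V) :
  connect e x y -> exists n, walk_of_length x y n.
Proof.
case/connectP => p xp ->; exists (size p).
by apply/existsP; exists (in_tuple p); rewrite xp eqxx.
Qed.

(* None stands for infinite distance. *)
Definition gdist (x y : V) : option nat :=
  if @idP (connect e x y) is ReflectT xy then Some (ex_minn (connect_walk xy))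
  else None.

(* Pairs at infinite distance contribute 0, so this is the largest diameter
   of a connected component. *)
Definition diameter : nat := \max_(x : V) \max_(y : V) odflt 0 (gdist x y).

Definition dist_nbhd (D : {pred nat}) (x : V) : {set V} :=
  [set y | if gdist x y is Some n then n \in D else false].

(* f is a bijection from V onto {1, ..., #|V|}. *)
Definition labeling (f : V -> nat) : Prop :=
  injective f /\ forall n, (n \in codom f) = (1 <= n <= #|V|).

Definition distance_magic_labeling (D : {pred nat}) (f : V -> nat) : Prop :=
  labeling f /\ exists k, forall x, \sum_(y in dist_nbhd D x) f y = k.

Definition distance_magic (D : {pred nat}) : Prop :=
  exists f, distance_magic_labeling D f.

Lemma gdistP (x y : V) n :
  gdist x y = Some n <->
  walk_of_length x y n /\ forall m, walk_of_length x y m -> n <= m.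
Proof.
rewrite /gdist; case: {-}_ / idP => [xy | nxy].
  case: ex_minnP => m wm min_m; split=> [[<-] // | [wn min_n]].
  by congr Some; apply/eqP; rewrite eqn_leq min_m // min_n.
split=> // -[/existsP[p /andP[xp /eqP yE]] _].
by case: nxy; apply/connectP; exists p.
Qed.

End Graph.

(* Main.v *)
Require Import Defs.
From mathcomp Require Import all_boot.

(** In both cases the graph contains two distinct vertices [x] and [y] with the
    same nonempty neighborhood; for two pendant vertices attached to [z] it is
    the singleton of [z].  Such twins are at distance 2
    ([gdist_between_twins]).  A walk from [x] to
    a third vertex starts with a step to a common neighbor, so the same walk
    can be started from [y], and twins have equal distances to every other
    vertex ([gdist_twin]).  As 2 is in [D] and 0 is not, the sets [N_D(x)] and
    [N_D(y)] therefore differ only in that the first contains [y] and the second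
    contains [x] ([dist_nbhd_twinD1]).  Equality of the two sums of labels then
    gives [f x = f y], against the injectivity of the labeling. *)

Section Twins.

Variables (V : finType) (e : rel V).

Lemma gdistxx x : gdist e x x = Some 0.
Proof.
by apply/gdistP; split=> //; apply/existsP; exists [tuple]; rewrite /= eqxx.
Qed.

Lemma eq_gdist x y z t :
  (forall n, walk_of_length e x y n = walk_of_length e z t n) ->
  gdist e x y = gdist e z t.
Proof.
move=> eq_w; case zt: (gdist e z t) => [n|].
  case/gdistP: zt => wn min_n; apply/gdistP.
  by split=> [|m]; rewrite eq_w //; apply: min_n.
case xy: (gdist e x y) => [n|] //; case/gdistP: xy => wn min_n.
rewrite -zt; apply/esym/gdistP.
by split=> [|m]; rewrite -eq_w //; apply: min_n.
Qed.

(** Every neighbor of [x] is a neighbor of [y], so changing only the starting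
    point of a nonempty walk from [x] gives a walk from [y] of the same length.
    The distances agree even when they are infinite. *)
Lemma gdist_twin x y w :
  nbhd e x = nbhd e y -> w != x -> w != y -> gdist e x w = gdist e y w.
Proof.
move=> /setP eq_nb wx wy; apply: eq_gdist => n; apply: eq_existsb => p.
(* The same list of successors is a walk from [x] and from [y], unless it is
   empty and the walk stays at its starting point. *)
case: (tval p) => [|t s] /=; first by rewrite ![_ == w]eq_sym (negPf wx) (negPf wy).
by have := eq_nb t; rewrite !inE => ->.
Qed.

Hypothesis e_sym : symmetric e.
Hypothesis e_irr : irreflexive e.

(** The common neighbor gives a walk of length 2, and twins are not adjacent:
    a neighbor [y] of [x] would also be a neighbor of [y]. *)
Lemma gdist_between_twins x y z :
  x != y -> nbhd e x = nbhd e y -> e x z -> gdist e x y = Some 2.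
Proof.
move=> xy /setP eq_nb xz; apply/gdistP; split.
  apply/existsP; exists [tuple z; y] => /=.
  by move: (eq_nb z); rewrite !inE xz e_sym => <-; rewrite eqxx.
case=> [|[|//]] /existsP[p].
  by rewrite tuple0 /= (negPf xy).
case/tupleP: p => t p; rewrite tuple0 /= andbT => /andP[xt /eqP ty].
by move: (eq_nb t); rewrite !inE xt ty e_irr.
Qed.

(** By [0 \notin D], [x] is not in [N_D(x)] and [y] is not in [N_D(y)], so each
    side omits both twins; at any other vertex the two distances coincide. *)
Lemma dist_nbhd_twinD1 (D : {pred nat}) x y :
  0 \notin D -> nbhd e x = nbhd e y ->
  dist_nbhd e D x :\ y = dist_nbhd e D y :\ x.
Proof.
move=> D0 eq_nb; apply/setP => w; rewrite !inE.
have [-> | wx] := eqVneq w x.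
  by rewrite gdistxx (negPf D0) andbF.
have [-> | wy] := eqVneq w y.
  by rewrite gdistxx (negPf D0).
by rewrite (gdist_twin _ y).
Qed.

(** Removing [y] from [N_D(x)] and [x] from [N_D(y)] leaves the same set, so the
    two equal sums of labels differ only by the terms [f y] and [f x]. *)
Lemma twins_not_distance_magic (D : {pred nat}) x y z :
  2 \in D -> 0 \notin D -> x != y -> nbhd e x = nbhd e y -> e x z ->
  ~ distance_magic e D.
Proof.
move=> D2 D0 xy eq_nb xz [f [[f_inj _] [k sum_f]]].
have yz : e y z by move/setP/(_ z): eq_nb; rewrite !inE xz.
have y_in : y \in dist_nbhd e D x by rewrite inE (gdist_between_twins _ _ z).
have x_in : x \in dist_nbhd e D y by rewrite inE (gdist_between_twins _ _ z) // eq_sym.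
have := sum_f x; rewrite -(sum_f y) (big_setD1 y) //= [RHS](big_setD1 x) //=.
rewrite dist_nbhd_twinD1 // => /addIn/f_inj yx.
by rewrite yx eqxx in xy.
Qed.

Lemma pendant_nbhd x z : pendant e x -> e x z -> nbhd e x = [set z].
Proof.
move=> /cards1P[t nbE] xz; rewrite nbE; congr [set _].
by apply/esym/eqP; rewrite -in_set1 -nbE inE.
Qed.

End Twins.

Theorem lemma13 (V : finType) (e : rel V) (e_sym : symmetric e)
    (e_irr : irreflexive e) (D : {pred nat})
    (diam_ge2 : 2 <= diameter e)
    (D_sub : forall n, n \in D -> n <= diameter e)
    (D2 : 2 \in D) (D0 : 0 \notin D)
    (h : (exists x y z : V,
            [/\ x != y, pendant e x, pendant e y, e x z & e y z])
         \/
         (exists x y : V, gdist e x y = Some 2 /\ nbhd e x = nbhd e y)) :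
  ~ distance_magic e D.
Proof.
case: h => [[x [y [z [xy px py xz yz]]]] | [x [y [dxy eq_nb]]]].
  apply: (twins_not_distance_magic _ _ e_sym e_irr _ x y z) => //.
  by rewrite (pendant_nbhd _ _ _ z) // (pendant_nbhd _ _ _ z).
have xy : x != y by apply: contra_eq_neq dxy => ->; rewrite gdistxx.
(* The first step of a walk of length 2 provides a common neighbor. *)
have /gdistP[/existsP[p /andP[xp _]] _] := dxy.
case/tupleP: p xp => z p /= /andP[xz _].
exact: (twins_not_distance_magic _ _ e_sym e_irr _ x y z).
Qed.
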